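(* Let $d$ be odd and let $t>1$ be an integer. Then there exists no $\mathrm{EITFF}_t$ on $G_{2,d}$; that is, no finite subset of $G_{2,d}$ is simultaneously equi-isoclinic and an equal-weight tight $t$-fusion frame.
   Context: $G_{2,d}$ is the set of $2$-dimensional linear subspaces of $\mathbb R^d$; $P_V$ is the orthogonal projection onto $V$. Principal angles: for $V,W\in G_{2,d}$ let $Q_V,Q_W\in\mathbb R^{d\times2}$ have orthonormal columns spanning $V,W$, and let $\sigma_1\ge\sigma_2\ge0$ be the singular values of $Q_V^{\mathsf T}Q_W$ (they lie in $[0,1]$ and do not depend on the bases). The principal angles are $\theta_i(V,W)=\arccos\sigma_i\in[0,\pi/2]$, $i=1,2$. A finite set $\{V_i\}_{i=1}^N\subset G_{2,d}$ (distinct planes) is equi-isoclinic if there is $\theta\in[0,\pi/2]$ with $\theta_\ell(V_i,V_j)=\theta$ for all $i\ne j$ and $\ell=1,2$. Equal-weight tight $t$-fusion frame: a finite set $X\subset G_{2,d}$ such that for some $A>0$, $\sum_{V\in X}\|P_Vx\|^{2t}=A\|x\|^{2t}$ for all $x\in\mathbb R^d$. *)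

(* Defs.v *)
From HB Require Import structures.
From mathcomp Require Import all_boot all_order all_algebra.
From mathcomp Require Import finmap.
From mathcomp Require Import boolp classical_sets reals trigo.
From mathcomp Require Import ring lra.

Set Implicit Arguments.
Unset Strict Implicit.
Unset Printing Implicit Defensive.

Import Order.TTheory GRing.Theory Num.Theory.

Local Open Scope ring_scope.

Section Euclidean.
Context {R : realType} {d : nat}.
Implicit Types (u v x : 'cV[R]_d) (V : {vspace 'cV[R]_d}).

Definition dotv u v : R := (u^T *m v) 0 0.

Lemma dotvE u v : dotv u v = \sum_i u i 0 * v i 0.
Proof. by rewrite /dotv mxE; apply: eq_bigr => i _; rewrite mxE. Qed.

Lemma dotv_is_bilinear : bilinear_for *%R (idfun \; *%R) dotv.
Proof.
split => [v a x y|u a x y] /=; rewrite /dotv.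
  by rewrite linearP /= mulmxDl -scalemxAl !mxE.
by rewrite mulmxDr -scalemxAr !mxE.
Qed.

HB.instance Definition _ :=
  bilinear_isBilinear.Build R 'cV[R]_d 'cV[R]_d R *%R (idfun \; *%R) dotv
    dotv_is_bilinear.

Lemma dotv_is_hermitian u v :
  dotv u v = (-1) ^+ false * idfun (dotv v u).
Proof.
by rewrite expr0 mul1r /= !dotvE; apply: eq_bigr => i _; rewrite mulrC.
Qed.

HB.instance Definition _ :=
  isHermitianSesquilinear.Build R 'cV[R]_d false idfun dotv dotv_is_hermitian.

Lemma dotvC u v : dotv u v = dotv v u.
Proof. by rewrite dotv_is_hermitian expr0 mul1r. Qed.

Lemma dotvBl u v x : dotv (u - v) x = dotv u x - dotv v x.
Proof. by rewrite /dotv linearB /= mulmxBl !mxE. Qed.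

Lemma dotvZl (a : R) u v : dotv (a *: u) v = a * dotv u v.
Proof. by rewrite /dotv linearZ /= -scalemxAl mxE. Qed.

Lemma dotvZr (a : R) u v : dotv u (a *: v) = a * dotv u v.
Proof. by rewrite dotvC dotvZl dotvC. Qed.

(* The norm `|x| that the analysis library puts on matrices is the sup norm. *)
Definition enorm x : R := Num.sqrt (dotv x x).

Lemma dotvv_ge0 x : 0 <= dotv x x.
Proof. by rewrite dotvE sumr_ge0 // => i _; rewrite -expr2 sqr_ge0. Qed.

Lemma dotvv_eq0 x : (dotv x x == 0) = (x == 0).
Proof.
apply/eqP/eqP => [|->]; last by rewrite dotvE big1 // => i _; rewrite mxE mul0r.
rewrite dotvE => /eqP; rewrite psumr_eq0; last first.
  by move=> i _; rewrite -expr2 sqr_ge0.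
move=> /allP x0; apply/colP => i; rewrite mxE.
by have := x0 i (mem_index_enum _); rewrite -expr2 sqrf_eq0 => /eqP.
Qed.

Definition orthproj V : 'End('cV[R]_d) := daddv_pi V (orthov dotv V).

Lemma capv_orthov V : (V :&: orthov dotv V = 0)%VS.
Proof.
apply/eqP; rewrite -subv0; apply/subvP => x; rewrite memv_cap memv0.
by move=> /andP[xV /mem_orthovP/(_ _ xV)/eqP]; rewrite dotvv_eq0.
Qed.

Lemma orthonormal_seq_exists V :
  exists2 s : seq 'cV[R]_d,
    <<s>>%VS = V & size s = \dim V /\
    forall i j, (i < size s)%N -> (j < size s)%N ->
      dotv s`_i s`_j = (i == j)%:R.
Proof.
have [k] := ubnP (\dim V); elim: k V => // k IHk V leVk.
have [V0|/negPf V0] := eqVneq V 0%VS.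
  by exists [::]; rewrite V0 ?span_nil ?dimv0.
pose v := vpick V.
have vn0 : dotv v v != 0 by rewrite dotvv_eq0 vpick0 V0.
pose u := (Num.sqrt (dotv v v))^-1 *: v.
have uV : u \in V by rewrite memvZ ?memv_pick.
have uu : dotv u u = 1.
  rewrite dotvZl dotvZr mulrA -expr2 exprVn.
  by rewrite sqr_sqrtr ?dotvv_ge0 ?mulVf.
have uNV : u \notin orthov dotv V.
  by apply/mem_orthovPn; exists u; rewrite //= uu oner_neq0.
pose V' := (V :&: orthov dotv <[u]>)%VS.
have dV : (0 < \dim V)%N by rewrite lt0n dimv_eq0 V0.
have dV' : (\dim V).-1 = \dim V' by apply: eq_dim_orthov1.
have [|s' sV' [szs' os']] := IHk V'.
  by rewrite -dV' prednK.
have us' i : (i < size s')%N -> dotv s'`_i u = 0.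
  move=> ilt; have : s'`_i \in V' by rewrite -sV' memv_span ?mem_nth.
  by rewrite memv_cap => /andP[_]; rewrite mem_orthov1 => /eqP.
exists (u :: s').
  rewrite span_cons sV'; apply/eqP; rewrite eqEsubv; apply/andP; split.
    by rewrite subv_add -memvE uV capvSl.
  apply/subvP => x xV.
  have xV' : x - dotv x u *: u \in V'.
    rewrite memv_cap; apply/andP; split; first exact: memvB xV (memvZ _ uV).
    rewrite mem_orthov1.
    by rewrite -[_ == 0]/(dotv _ _ == 0) dotvBl dotvZl uu mulr1 subrr.
  rewrite -[x](subrK (dotv x u *: u)) addrC.
  by apply: memv_add xV'; apply: memvZ (memv_line u).
split=> /=; first by rewrite szs' -dV' prednK.
case=> [|i] [|j] //=; rewrite ?ltnS => il jl.
- by rewrite dotvC us'.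
- by rewrite us'.
- by rewrite os'.
Qed.

(* The columns of Q are orthonormal and span V. *)
Definition is_orthobasis k V (Q : 'M[R]_(d, k)) : Prop :=
  Q^T *m Q = 1%:M /\ <<[seq col j Q | j : 'I_k]>>%VS = V.

Definition orthobasis k V : 'M[R]_(d, k) := xget 0 [set Q | is_orthobasis V Q].

Lemma orthobasisP k V : \dim V = k -> is_orthobasis V (orthobasis k V).
Proof.
move=> dV; apply: xgetPex.
have [s sV [szs os]] := orthonormal_seq_exists V.
have {}szs : size s = k by rewrite szs.
pose Q : 'M[R]_(d, k) := \matrix_(i, j) (s`_j) i 0.
have cQ j : col j Q = s`_j by apply/colP => i; rewrite !mxE.
exists Q; split.
  apply/matrixP => i j; rewrite !mxE -val_eqE /= -os ?szs ?ltn_ord // dotvE.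
  by apply: eq_bigr => l _; rewrite !mxE.
rewrite -sV; congr (<<_>>%VS).
apply: (@eq_from_nth _ 0); first by rewrite size_map size_enum_ord szs.
move=> i; rewrite size_map size_enum_ord => ilt.
by rewrite (nth_map (Ordinal ilt)) ?size_enum_ord // cQ nth_enum_ord.
Qed.

Lemma is_orthobasis_col k V (Q : 'M[R]_(d, k)) j :
  is_orthobasis V Q -> col j Q \in V.
Proof.
by case=> _ <-; apply/memv_span/mapP; exists j => //; rewrite mem_enum.
Qed.

Lemma is_orthobasis_mem k V (Q : 'M[R]_(d, k)) x :
  is_orthobasis V Q -> x \in V -> Q *m (Q^T *m x) = x.
Proof.
move=> [QQ <-] xV.
suff [y ->] : exists y : 'cV_k, x = Q *m y.
  by rewrite (mulmxA Q^T) QQ mul1mx.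
have := coord_span (X := in_tuple [seq col j Q | j : 'I_k]) xV.
move=> ->; elim/big_ind: _ => [|a b [y ->] [z ->]|i _].
- by exists 0; rewrite mulmx0.
- by exists (y + z); rewrite mulmxDr.
set c := coord _ _ _; have /mapP[j _ ->] : (in_tuple [seq col j Q | j : 'I_k])`_i
    \in [seq col j Q | j : 'I_k] by rewrite mem_nth.
by exists (c *: delta_mx j 0); rewrite -scalemxAr -colE.
Qed.

Lemma is_orthobasis_change k V (Q Q' : 'M[R]_(d, k)) :
  is_orthobasis V Q -> is_orthobasis V Q' -> Q *m (Q^T *m Q') = Q'.
Proof.
move=> bQ bQ'.
suff e j : col j (Q *m (Q^T *m Q')) = col j Q'.
  by apply/matrixP => i j; have /colP/(_ i) := e j; rewrite ![col _ _ _ _]mxE.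
rewrite !colE -!mulmxA (is_orthobasis_mem bQ) // -colE.
exact: is_orthobasis_col bQ'.
Qed.

Lemma orthproj_mem V x : orthproj V x \in V.
Proof. exact: memv_pi. Qed.

Lemma orthproj_orth V x : x - orthproj V x \in orthov dotv V.
Proof.
have [QQ sQ] := orthobasisP (erefl (\dim V)).
set Q := orthobasis _ V in QQ sQ.
pose y := Q *m (Q^T *m x).
have yV : y \in V.
  rewrite /y; move: (Q^T *m x) => z.
  have -> : Q *m z = \sum_j z j 0 *: col j Q.
    apply/colP => i; rewrite mxE summxE; apply: eq_bigr => j _.
    by rewrite !mxE mulrC.
  by apply: memv_suml => j _; apply/memvZ/(is_orthobasis_col j (conj QQ sQ)).
have oy : x - y \in orthov dotv V.
  apply/mem_orthovP => v /(is_orthobasis_mem (conj QQ sQ)) <-.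
  rewrite -[LHS]/(dotv _ _) dotvBl /dotv /y !trmx_mul trmxK -!mulmxA.
  by rewrite (mulmxA Q^T Q) QQ mul1mx subrr.
have xs : x \in (V + orthov dotv V)%VS.
  by rewrite -[x](subrK y) addrC memv_add.
have /(canRL (addrK _)) e := daddv_pi_add (capv_orthov V) xs.
by rewrite /orthproj {1}e opprB addrC subrK memv_pi.
Qed.

End Euclidean.

Section SingularValues.
Context {R : realType}.

(* The nonnegative square roots of the eigenvalues of A^T A, counted with
   multiplicity and listed in nonincreasing order. *)
Definition is_singular_values n (A : 'M[R]_n) (s : 'rV[R]_n) : Prop :=
  [/\ forall i, 0 <= s 0 i,
      forall i j : 'I_n, (i <= j)%N -> s 0 j <= s 0 i
    & char_poly (A^T *m A) = \prod_i ('X - (s 0 i ^+ 2)%:P)].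

Definition singular_values n (A : 'M[R]_n) : 'rV[R]_n :=
  xget 0 [set s | is_singular_values A s].

Lemma is_singular_values_uniq n (A : 'M[R]_n) s s' :
  is_singular_values A s -> is_singular_values A s' -> s = s'.
Proof.
move=> [s0 sd sc] [s'0 s'd]; rewrite {}sc => e.
pose l (s : 'rV[R]_n) := [seq s 0 i ^+ 2 | i <- enum 'I_n].
have lE (u : 'rV[R]_n) :
    \prod_i ('X - (u 0 i ^+ 2)%:P) = \prod_(a <- l u) ('X - a%:P).
  by rewrite big_map big_enum.
have lS (u : 'rV[R]_n) : (forall i, 0 <= u 0 i) ->
    (forall i j : 'I_n, (i <= j)%N -> u 0 j <= u 0 i) -> sorted >=%O (l u).
  move=> u0 ud; rewrite sorted_map.
  have := iota_sorted 0 n; rewrite -val_enum_ord sorted_map.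
  apply: sub_sorted => i j /= /ud uji.
  by rewrite ler_pXn2r // nnegrE u0.
have ll : l s = l s'.
  apply: (sorted_eq (leT := >=%O)) => //.
  - by move=> a b c /= ba ac; apply: le_trans ac ba.
  - by move=> a b /= /andP[ba ab]; apply/eqP; rewrite eq_le ab ba.
  - exact: lS.
  - exact: lS.
  by rewrite prod_XsubC_eq //; rewrite -!lE.
apply/rowP => i.
have ln (u : 'rV[R]_n) : nth 0 (l u) i = u 0 i ^+ 2.
  by rewrite /l (nth_map i) ?size_enum_ord // nth_ord_enum.
have /(congr1 (nth 0 ^~ i)) /= := ll; rewrite !ln => /eqP.
by rewrite eqrXn2 // => /eqP.
Qed.

Lemma is_singular_values_similar n (A U V : 'M[R]_n) s :
  U^T *m U = 1%:M -> V^T *m V = 1%:M ->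
  is_singular_values A s -> is_singular_values (U^T *m A *m V) s.
Proof.
move=> UU VV [s0 sd sc]; split=> //; rewrite -sc.
have UU' := mulmx1C UU; have VV' := mulmx1C VV.
have -> : (U^T *m A *m V)^T *m (U^T *m A *m V) = V^T *m (A^T *m A) *m V.
  by rewrite !trmx_mul trmxK -!mulmxA (mulmxA U U^T) UU' mul1mx.
rewrite /char_poly /char_poly_mx.
have -> : 'X%:M - map_mx polyC (V^T *m (A^T *m A) *m V) =
  map_mx polyC V^T *m ('X%:M - map_mx polyC (A^T *m A)) *m map_mx polyC V.
  rewrite mulmxBr mulmxBl -!map_mxM /=; congr (_ - _).
  have VVp : map_mx polyC V^T *m map_mx polyC V = 1%:M.
    by rewrite -map_mxM VV map_mx1.
  by rewrite scalar_mxC -mulmxA VVp mulmx1.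
rewrite !det_mulmx mulrC mulrA -det_mulmx -map_mxM VV' map_mx1 det1.
by rewrite mul1r.
Qed.

Lemma det22 (A : 'M[R]_2) : \det A = A 0 0 * A 1 1 - A 0 1 * A 1 0.
Proof.
rewrite (expand_det_row _ 0) !big_ord_recl big_ord0 /cofactor !det_mx11 !mxE /=.
have -> : lift 0 0 = 1 :> 'I_2 by apply/val_inj.
have -> : lift 1 0 = 0 :> 'I_2 by apply/val_inj.
by ring.
Qed.

Lemma char_poly22 (A : 'M[R]_2) :
  char_poly A = 'X^2 - (\tr A) *: 'X + (\det A)%:P.
Proof.
apply/polyP => i; rewrite !coefD coefN coefZ coefXn coefX coefC.
case: i => [|[|[|i]]] /=.
- by rewrite char_poly_det sqrrN expr1n mul1r mulr0 subr0 add0r.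
- by rewrite (char_poly_trace A (n := 2)) // mulr1 add0r addr0.
- have /monicP := char_poly_monic A; rewrite lead_coefE size_char_poly => ->.
  by rewrite mulr0 subr0 addr0.
- by rewrite nth_default ?size_char_poly // mulr0 subr0 addr0.
Qed.

Lemma singular_valuesP (A : 'M[R]_2) : is_singular_values A (singular_values A).
Proof.
apply: xgetPex; pose B := A^T *m A.
pose T := \tr B; pose D := \det B.
have D0 : 0 <= D by rewrite /D det_mulmx det_tr -expr2 sqr_ge0.
have T0 : 0 <= T.
  rewrite /T mxtrace_mulC /mxtrace sumr_ge0 // => i _; rewrite mxE sumr_ge0 //.
  by move=> j _; rewrite mxE -expr2 sqr_ge0.
have disc : 0 <= T ^+ 2 - 4 * D.
  have symB : B 1 0 = B 0 1.
    have BT : B^T = B by rewrite /B trmx_mul trmxK.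
    by rewrite -[in LHS]BT mxE.
  have -> : D = B 0 0 * B 1 1 - B 0 1 ^+ 2.
    by rewrite /D det22 symB expr2.
  have -> : T = B 0 0 + B 1 1.
    rewrite /T /mxtrace !big_ord_recl big_ord0 addr0.
    by have -> : lift 0 0 = 1 :> 'I_2 by apply/val_inj.
  rewrite (_ : _ - _ = (B 0 0 - B 1 1) ^+ 2 + 4 * B 0 1 ^+ 2); last by ring.
  by rewrite addr_ge0 ?sqr_ge0 // mulr_ge0 ?ler0n ?sqr_ge0.
pose r := Num.sqrt (T ^+ 2 - 4 * D).
have r0 : 0 <= r by apply: sqrtr_ge0.
have rr : r ^+ 2 = T ^+ 2 - 4 * D by rewrite sqr_sqrtr.
have rT : r <= T by rewrite -ler_sqr ?nnegrE // rr; lra.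
pose l (i : 'I_2) := if i == 0 then (T + r) / 2 else (T - r) / 2.
have l0 i : 0 <= l i by rewrite /l; case: ifP => _; lra.
exists (\row_i Num.sqrt (l i)); split=> [i|i j ij|].
- by rewrite mxE sqrtr_ge0.
- rewrite !mxE ler_sqrt //; move: ij; rewrite /l.
  case: i j => [[|[|//]] ?] [[|[|//]] ?] //= _; lra.
rewrite char_poly22 -/B -/T -/D !big_ord_recl big_ord0 mulr1 !mxE !sqr_sqrtr //.
have -> : lift 0 0 = 1 :> 'I_2 by apply/val_inj.
rewrite /l /=; set a := (T + r) / 2; set b := (T - r) / 2.
have -> : T = a + b by rewrite /a /b; field.
have -> : D = a * b.
  have -> : D = (T ^+ 2 - r ^+ 2) / 4 by rewrite rr; field.
  by rewrite /a /b; field.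
by rewrite polyCM -mul_polyC polyCD; ring.
Qed.

End SingularValues.

Record grassmannian (R : realType) (k d : nat) := Grassmannian {
  grassmannian_vspace :> {vspace 'cV[R]_d};
  _ : \dim grassmannian_vspace == k }.

HB.instance Definition _ (R : realType) (k d : nat) :=
  [isSub for @grassmannian_vspace R k d].
HB.instance Definition _ (R : realType) (k d : nat) :=
  [Choice of grassmannian R k d by <:].

Section FusionFrames.
Context {R : realType} {d : nat}.
Implicit Types (V W : grassmannian R 2 d) (X : {fset grassmannian R 2 d}).

(* The bases are chosen ones; principal_angleE says that any others give the
   same angles. *)
Definition principal_angle V W (l : 'I_2) : R :=
  acos (singular_values ((orthobasis 2 V)^T *m orthobasis 2 W) 0 l).

Lemma principal_angleE V W (QV QW : 'M[R]_(d, 2)) (s : 'rV[R]_2) (l : 'I_2) :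
  is_orthobasis V QV -> is_orthobasis W QW ->
  is_singular_values (QV^T *m QW) s -> principal_angle V W l = acos (s 0 l).
Proof.
move=> bV bW sP; rewrite /principal_angle.
have bV' : is_orthobasis V (orthobasis 2 V).
  exact: orthobasisP (eqP (valP V)).
have bW' : is_orthobasis W (orthobasis 2 W).
  exact: orthobasisP (eqP (valP W)).
set QV' := orthobasis 2 V in bV' *; set QW' := orthobasis 2 W in bW' *.
have orth (U : grassmannian R 2 d) (Q Q' : 'M[R]_(d, 2)) : is_orthobasis U Q ->
    is_orthobasis U Q' -> (Q^T *m Q')^T *m (Q^T *m Q') = 1%:M.
  move=> bQ bQ'; rewrite trmx_mul trmxK -mulmxA (is_orthobasis_change bQ bQ').
  by case: bQ'.
have e : QV'^T *m QW' = (QV^T *m QV')^T *m (QV^T *m QW) *m (QW^T *m QW').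
  rewrite trmx_mul trmxK -!mulmxA (is_orthobasis_change bW bW') !mulmxA.
  have -> : QV'^T *m QV *m QV^T = QV'^T; last by [].
  by apply: trmx_inj; rewrite !trmx_mul !trmxK (is_orthobasis_change bV bV').
suff -> : singular_values (QV'^T *m QW') = s by [].
apply: is_singular_values_uniq (singular_valuesP _) _.
rewrite e; apply: is_singular_values_similar sP.
  exact: orth bV bV'.
exact: orth bW bW'.
Qed.

Definition equi_isoclinic X : Prop :=
  exists2 theta : R, 0 <= theta <= pi / 2 &
    forall V W, V \in X -> W \in X -> V != W ->
      forall l : 'I_2, principal_angle V W l = theta.

Definition tight_fusion_frame (t : nat) X : Prop :=
  exists2 A : R, 0 < A &
    forall x : 'cV[R]_d,
      \sum_(V <- X) enorm (orthproj (V : grassmannian R 2 d) x) ^+ (2 * t)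
      = A * enorm x ^+ (2 * t).

(* Equi-isoclinic tight t-fusion frame. *)
Definition EITFF (t : nat) X : Prop :=
  equi_isoclinic X /\ tight_fusion_frame t X.

End FusionFrames.

(* Main.v *)
Require Import Defs.
From mathcomp Require Import all_boot all_order all_algebra.
From mathcomp Require Import finmap reals.
From mathcomp Require Import trigo.
From mathcomp Require Import ring lra.

(** Nonexistence comes from counting: an equi-isoclinic tight [t]-fusion frame
    of planes with [t > 1] and [d != 2] has exactly [d ^ 2 / 4] members
    ([EITFF_card]), which is not an integer when [d] is odd.

    Write [p_V x] for the squared norm of the projection of [x] on [V].  The
    Laplacian sends [p_V ^ t] to a multiple of [p_V ^ (t - 1)], and likewise for
    [`|x| ^ 2] in place of [p_V] ([laplacian_sqn]).  So the Laplacian of the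
    identity [\sum_V p_V x ^ t = A_t * `|x| ^ (2 * t)] is, up to a factor, the
    same identity with exponent [t - 1] and constant
    [A_(t - 1) = A_t * (d + 2 * t - 2) / (2 * t)] ([tight_descend]).  At exponent
    [0] the constant is the number [N] of planes; hence [A_1 = 2 * N / d] and
    [A_2 = 8 * N / (d * (d + 2))].

    If moreover all principal angles equal [theta], then a unit vector [x] of a
    member [W] has [p_W x = 1], and [p_V x = lam] with [lam = cos theta ^ 2] for
    every other member [V] ([isoclinic_sqn]).  The identities of exponents [1]
    and [2] at this [x] read [A_1 = 1 + (N - 1) * lam] and
    [A_2 = 1 + (N - 1) * lam ^ 2].  Eliminating [lam] through
    [(A_1 - 1) ^ 2 = (N - 1) * (A_2 - 1)] leaves [(d - 2) * (4 * N - d ^ 2) = 0]. *)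

Set Implicit Arguments.
Unset Strict Implicit.
Unset Printing Implicit Defensive.

Import Order.TTheory GRing.Theory Num.Theory.

Local Open Scope ring_scope.

(** * Squared norms and orthogonal projections *)

Section SquaredNorm.
Context {R : realType}.

(** [sqn] is the square of [enorm], so that the even powers of [enorm] become
    polynomial. *)
Definition sqn n (y : 'cV[R]_n) : R := dotv y y.

Lemma sqnE n (y : 'cV[R]_n) : sqn y = \sum_i y i 0 ^+ 2.
Proof. by rewrite /sqn dotvE; apply: eq_bigr => i _; rewrite expr2. Qed.

Lemma enorm_exp_even n (y : 'cV[R]_n) t : enorm y ^+ (2 * t) = sqn y ^+ t.
Proof. by rewrite exprM sqr_sqrtr // dotvv_ge0. Qed.

Lemma dotv_mulmx m n (M : 'M[R]_(m, n)) x y :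
  dotv (M *m x) y = dotv x (M^T *m y).
Proof. by rewrite /dotv trmx_mul mulmxA. Qed.

Lemma sqn_line n (u v : 'cV[R]_n) (s : R) :
  sqn (u + s *: v) = sqn u + 2 * dotv u v * s + sqn v * s ^+ 2.
Proof.
rewrite /sqn !dotvE !mulr_sumr !mulr_suml -!big_split /=.
by apply: eq_bigr => i _; rewrite !mxE; ring.
Qed.

Context {d k : nat}.
Implicit Types Q : 'M[R]_(d, k).

Lemma sqn_isometry Q y : Q^T *m Q = 1%:M -> sqn (Q *m y) = sqn y.
Proof. by move=> QQ; rewrite /sqn dotv_mulmx mulmxA QQ mul1mx. Qed.

Lemma sqn_tr_le Q x : Q^T *m Q = 1%:M -> sqn (Q^T *m x) <= sqn x.
Proof.
move=> QQ; set y := Q^T *m x.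
have e : dotv (Q *m y) x = sqn y by rewrite dotv_mulmx.
(* Pythagoras: the difference is the squared norm of x - Q Q^T x. *)
have := dotvv_ge0 (x + (-1) *: (Q *m y)).
rewrite -/(sqn _) sqn_line dotvC e sqn_isometry //; lra.
Qed.

Lemma orthproj_orthobasis (V : {vspace 'cV[R]_d}) Q x :
  is_orthobasis V Q -> orthproj V x = Q *m (Q^T *m x).
Proof.
move=> bQ; rewrite -[LHS](is_orthobasis_mem bQ (orthproj_mem V x)).
congr (_ *m _); apply/esym/eqP; rewrite -subr_eq0 -mulmxBr; apply/eqP/colP => j.
have /mem_orthovP /(_ _ (is_orthobasis_col j bQ)) := orthproj_orth V x.
rewrite -[X in X = _]/(dotv _ _) dotvE => e; rewrite [RHS]mxE -[RHS]e mxE.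
by apply: eq_bigr => i _; rewrite mulrC; congr (_ * _); rewrite !mxE.
Qed.

Lemma enorm_orthproj (V : {vspace 'cV[R]_d}) Q x t :
  is_orthobasis V Q -> enorm (orthproj V x) ^+ (2 * t) = sqn (Q^T *m x) ^+ t.
Proof.
move=> bQ; rewrite enorm_exp_even (orthproj_orthobasis x bQ) sqn_isometry //.
by case: bQ.
Qed.

End SquaredNorm.

(** * Laplacians of powers of squared projections *)

Section Laplacian.
Context {R : realType} {d : nat}.

Lemma poly_ext_horner (p q : {poly R}) : (forall s, p.[s] = q.[s]) -> p = q.
Proof.
move=> pq; apply/eqP; rewrite -subr_eq0; apply/eqP.
apply: (@roots_geq_poly_eq0 _ _ [seq i%:R | i <- iota 0 (size (p - q))]).
- by apply/allP => s _; rewrite rootE !hornerE pq subrr.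
- by rewrite map_inj_uniq ?iota_uniq // => i j /eqP; rewrite eqr_nat => /eqP.
- by rewrite size_map size_iota.
Qed.

Definition sqn_line_poly n (u v : 'cV[R]_n) : {poly R} :=
  (sqn u)%:P + (2 * dotv u v) *: 'X + sqn v *: 'X^2.

Lemma horner_sqn_line_poly n (u v : 'cV[R]_n) s :
  (sqn_line_poly u v).[s] = sqn (u + s *: v).
Proof. by rewrite sqn_line !hornerE. Qed.

Lemma deriv2_exp (p : {poly R}) t s :
  (p ^+ t.+1)^`()^`().[s] =
  t.+1%:R * (p^`()^`().[s] * p.[s] ^+ t + t%:R * p^`().[s] ^+ 2 * p.[s] ^+ t.-1).
Proof.
rewrite deriv_exp derivMn derivM deriv_exp /= hornerMn hornerD !hornerM hornerMn.
rewrite hornerM !horner_exp -[LHS]mulr_natl; congr (_ * (_ + _)).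
by rewrite mulrnAr -[LHS]mulr_natl; ring.
Qed.

Lemma deriv2_sqn_line_poly_exp n (u v : 'cV[R]_n) t :
  (sqn_line_poly u v ^+ t.+1)^`()^`().[0] =
  t.+1%:R * (2 * sqn v * sqn u ^+ t
             + 4 * t%:R * dotv u v ^+ 2 * sqn u ^+ t.-1).
Proof.
have d1 : (sqn_line_poly u v)^`() = (2 * dotv u v)%:P + (2 * sqn v) *: 'X.
  rewrite /sqn_line_poly !derivD derivC !derivZ derivX derivXn add0r alg_polyC.
  by rewrite [2 * sqn v]mulrC -scalerA scaler_nat.
rewrite deriv2_exp horner_sqn_line_poly scale0r addr0 d1.
rewrite derivD derivC derivZ derivX add0r alg_polyC !(hornerD, hornerZ, hornerC, hornerX).
ring.
Qed.

(** The Laplacian of [sqn (Q^T *m x) ^+ t.+1] at [u], computed as the sum of the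
    second derivatives along the coordinate axes.  The factor [k + 2 * t] is the
    one that [`|y| ^ (2 * t + 2)] has in dimension [k]: the function only depends
    on the component of [u] in the column space of [Q]. *)
Lemma laplacian_sqn k (Q : 'M[R]_(d, k)) (u : 'cV[R]_d) t : Q^T *m Q = 1%:M ->
  \sum_i (sqn_line_poly (Q^T *m u) (Q^T *m delta_mx i 0) ^+ t.+1)^`()^`().[0]
  = 2 * t.+1%:R * (k + 2 * t)%:R * sqn (Q^T *m u) ^+ t.
Proof.
move=> QQ.
under eq_bigr do rewrite deriv2_sqn_line_poly_exp.
rewrite -mulr_sumr big_split /= -!mulr_suml -!mulr_sumr.
have -> : \sum_i sqn (Q^T *m delta_mx i 0) = k%:R.
  (* The sum is the squared Hilbert-Schmidt norm of Q, that is, tr (Q^T Q). *)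
  rewrite -[RHS]mxtrace1 -QQ mxtrace_mulC; apply: eq_bigr => i _.
  rewrite -colE sqnE mxE; apply: eq_bigr => j _; rewrite !mxE expr2; ring.
have -> : \sum_i dotv (Q^T *m u) (Q^T *m delta_mx i 0) ^+ 2 = sqn (Q^T *m u).
  rewrite -[RHS](sqn_isometry _ QQ) sqnE; apply: eq_bigr => i _.
  congr (_ ^+ 2); rewrite -{1}[Q]trmxK -dotv_mulmx trmxK dotvE (bigD1 i) //=.
  rewrite big1 => [|j /negPf ji]; rewrite [delta_mx _ _ _ _]mxE ?ji ?eqxx.
    by rewrite mulr1 addr0.
  by rewrite mulr0.
rewrite natrD natrM; case: t => [|t]; first by rewrite !expr0; ring.
by rewrite /= exprS; ring.
Qed.

(** Two sides that agree everywhere have the same Laplacian; restricting them to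
    the coordinate lines through [x] makes them polynomials in one variable. *)
Lemma tight_descend (I : Type) (r : seq I) k (Q : I -> 'M[R]_(d, k)) t (A : R) :
  (0 < k)%N -> (forall i, (Q i)^T *m Q i = 1%:M) ->
  (forall x, \sum_(i <- r) sqn ((Q i)^T *m x) ^+ t.+1 = A * sqn x ^+ t.+1) ->
  forall x, \sum_(i <- r) sqn ((Q i)^T *m x) ^+ t
            = A * ((d + 2 * t)%:R / (k + 2 * t)%:R) * sqn x ^+ t.
Proof.
move=> k0 QQ tA x.
have line v : \sum_(i <- r) sqn_line_poly ((Q i)^T *m x) ((Q i)^T *m v) ^+ t.+1
              = A *: sqn_line_poly x v ^+ t.+1.
  apply: poly_ext_horner => s; rewrite horner_sum hornerZ horner_exp.
  rewrite horner_sqn_line_poly -tA; apply: eq_bigr => i _.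
  by rewrite horner_exp horner_sqn_line_poly scalemxAr mulmxDr.
have /= := laplacian_sqn x t (Q := 1%:M).
rewrite trmx1 !mul1mx => /(_ erefl); under eq_bigr do rewrite mul1mx.
move=> lapR.
have e : 2 * t.+1%:R * (k + 2 * t)%:R * \sum_(j <- r) sqn ((Q j)^T *m x) ^+ t
         = A * (2 * t.+1%:R * (d + 2 * t)%:R * sqn x ^+ t).
  rewrite -lapR !mulr_sumr.
  under eq_bigr => j _ do rewrite -(laplacian_sqn x t (QQ j)).
  rewrite exchange_big; apply: eq_bigr => i _.
  by rewrite -hornerZ -!derivZ -line !linear_sum horner_sum.
have k0R : (k + 2 * t)%:R != 0 :> R by rewrite pnatr_eq0 -lt0n ltn_addr.
have c0 : 2 * t.+1%:R * (k + 2 * t)%:R != 0 :> R.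
  by rewrite !mulf_neq0 // pnatr_eq0.
apply: (mulfI c0); rewrite e; field; by rewrite -natrM -natrD.
Qed.

End Laplacian.

(** * Isoclinic planes *)

Section Isoclinic.
Context {R : realType}.

(** A symmetric matrix with a double eigenvalue is scalar; for a [2 x 2] matrix
    this is the vanishing of the discriminant, a sum of two squares. *)
Lemma sym22_double_eigenvalue (B : 'M[R]_2) (a : R) :
  B^T = B -> char_poly B = ('X - a%:P) ^+ 2 -> B = a%:M.
Proof.
move=> sB cB.
have sym : B 1 0 = B 0 1 by rewrite -[in LHS]sB mxE.
have tB : \tr B = B 0 0 + B 1 1.
  rewrite /mxtrace !big_ord_recl big_ord0 addr0.
  by have -> : lift 0 0 = 1 :> 'I_2 by apply/val_inj.
have c s : (char_poly B).[s] = (s - a) ^+ 2 by rewrite cB !hornerE.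
have := c 0; have := c 1.
rewrite char_poly22 !hornerE tB det22 sym => c1 c0.
have disc : (B 0 0 - B 1 1) ^+ 2 + (2 * B 0 1) ^+ 2 = 0.
  have tr2 : B 0 0 + B 1 1 = 2 * a by lra.
  have -> : (B 0 0 - B 1 1) ^+ 2 + (2 * B 0 1) ^+ 2
    = (B 0 0 + B 1 1) ^+ 2 - 4 * (B 0 0 * B 1 1 - B 0 1 * B 0 1) by ring.
  by rewrite tr2; lra.
move/eqP: disc; rewrite paddr_eq0 ?sqr_ge0 // !sqrf_eq0 mulf_eq0 pnatr_eq0 /=.
move=> /andP[/eqP dB /eqP oB].
have dgl : B 0 0 = a by lra.
have dgr : B 1 1 = a by lra.
apply/matrixP => i j; rewrite [RHS]mxE.
have o2 (l : 'I_2) : l = 0 \/ l = 1.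
  by case: l => [[|[|//]] ?]; [left|right]; apply/val_inj.
by case: (o2 i) (o2 j) => -> [] ->; rewrite ?sym ?dgl ?dgr ?oB ?mulr1n ?mulr0n.
Qed.

(** If [z] is an eigenvector of [M^T *m M] for the square of a singular value,
    that square is the ratio of [sqn (M *m z)] to [sqn z].  The bound is needed
    because [acos] determines its argument only on [[-1, 1]]. *)
Lemma singular_value_le1 n (M : 'M[R]_n) s i :
  (forall z, sqn (M *m z) <= sqn z) -> is_singular_values M s -> s 0 i <= 1.
Proof.
move=> contr [s0 _ cp].
have : eigenvalue (M^T *m M) (s 0 i ^+ 2).
  rewrite eigenvalue_root_char cp /root horner_prod (bigD1 i) //=.
  by rewrite !hornerE subrr mul0r.
case/eigenvalueP => z zE z0.
have ev : M^T *m (M *m z^T) = s 0 i ^+ 2 *: z^T.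
  by apply: trmx_inj; rewrite !trmx_mul !trmxK -mulmxA zE linearZ /= trmxK.
have := contr z^T; rewrite {1}/sqn dotv_mulmx ev dotvZr -/(sqn _) => le1.
have pos : 0 < sqn z^T.
  by rewrite lt_neqAle dotvv_ge0 eq_sym dotvv_eq0 andbT trmx_eq0.
move: le1; rewrite ger_pMl // => le1.
by rewrite -(@ler_pXn2r _ 2) ?nnegrE // expr1n.
Qed.

(** In orthonormal coordinates this is the orthogonal projection onto one space
    restricted to the other one. *)
Lemma cross_gram_contraction d k l (Q : 'M[R]_(d, k)) (P : 'M[R]_(d, l)) z :
  Q^T *m Q = 1%:M -> P^T *m P = 1%:M -> sqn (Q^T *m P *m z) <= sqn z.
Proof.
by move=> QQ PP; rewrite -mulmxA -(sqn_isometry z PP); apply: sqn_tr_le.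
Qed.

(** The left side is the quadratic form of the Gram matrix of [P^T *m Q], whose
    eigenvalues are the squared cosines of the principal angles; if these agree,
    the Gram matrix is scalar. *)
Lemma isoclinic_sqn d (V W : grassmannian R 2 d) (P Q : 'M[R]_(d, 2)) theta z :
  is_orthobasis V P -> is_orthobasis W Q ->
  (forall l, principal_angle V W l = theta) ->
  sqn (P^T *m (Q *m z)) = cos theta ^+ 2 * sqn z.
Proof.
move=> bP bQ ang.
have [s [s0 sd cp]] : exists s, is_singular_values (P^T *m Q) s.
  by exists (singular_values (P^T *m Q)); exact: singular_valuesP.
have sP : is_singular_values (P^T *m Q) s by [].
have sC i : s 0 i = cos theta.
  rewrite -(ang i) (principal_angleE i bP bQ sP) acosK // in_itv /=.
  rewrite (le_trans _ (s0 i)) ?lerN10 //=.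
  apply: singular_value_le1 sP => y.
  by apply: cross_gram_contraction; [case: bP | case: bQ].
have scal : (P^T *m Q)^T *m (P^T *m Q) = (cos theta ^+ 2)%:M.
  apply: sym22_double_eigenvalue; first by rewrite trmx_mul trmxK.
  by rewrite cp; under eq_bigr do rewrite sC; rewrite prodr_const card_ord.
by rewrite mulmxA /sqn dotv_mulmx mulmxA scal mul_scalar_mx dotvZr.
Qed.

End Isoclinic.

(** * Counting *)

(** The constants of exponents [1] and [2] are known multiples of the number [N]
    of planes, and each of them is also an expression in [N] and [lam].
    Eliminating [lam] leaves an equation for [N] alone, which is void when
    [d = 2]. *)
Lemma EITFF_card (R : realType) (d t : nat) (X : {fset grassmannian R 2 d}) :
  (0 < d)%N -> d != 2%N -> (1 < t)%N -> EITFF t X -> (4 * #|` X| = d ^ 2)%N.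
Proof.
move=> d0 d2 t1 [[theta _ iso] [A A0 tight]].
pose Q (V : grassmannian R 2 d) := orthobasis 2 V.
have bQ (V : grassmannian R 2 d) : is_orthobasis V (Q V).
  by apply: orthobasisP (eqP (valP V)).
have QQ V : (Q V)^T *m Q V = 1%:M by case: (bQ V).
have tightQ x : \sum_(V <- X) sqn ((Q V)^T *m x) ^+ t = A * sqn x ^+ t.
  rewrite -enorm_exp_even -tight; apply: eq_bigr => V _.
  by rewrite (enorm_orthproj x t (bQ V)).
have [A2 tight2] : exists A2, forall x,
    \sum_(V <- X) sqn ((Q V)^T *m x) ^+ 2 = A2 * sqn x ^+ 2.
  case: t t1 {tight} tightQ => [|[|t]] // _; elim: t A {A0} => [|t IH] B tB.
    by exists B.
  exact: IH (tight_descend _ QQ tB).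
have tight1 := tight_descend (ltn0Sn 1) QQ tight2.
have tight0 := tight_descend (ltn0Sn 1) QQ tight1.
move: tight1 tight0.
set A1 := A2 * _; set N := A1 * _ => tight1 tight0.
have cardX : N = #|` X|%:R.
  have := tight0 0; rewrite expr0 mulr1 => <-.
  under eq_bigr do rewrite expr0.
  by rewrite big_const_seq count_predT iter_addr_0.
have [W WX] : exists W, W \in X.
  apply/fset0Pn/negP => /eqP X0.
  (* With no planes the tight identity fails at every nonzero vector. *)
  have := tightQ (const_mx 1); rewrite X0 big_seq_fset0 => /esym/eqP.
  rewrite mulf_eq0 (gt_eqF A0) /= expf_eq0 dotvv_eq0 => /andP[_ /eqP/colP].
  by move=> /(_ (Ordinal d0)); rewrite !mxE => /eqP; rewrite oner_eq0.
pose z : 'cV[R]_2 := delta_mx 0 0; pose x := Q W *m z.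
have z1 : sqn z = 1.
  rewrite sqnE big_ord_recl big1 ?addr0 => [|i _];
    by rewrite !mxE ?expr1n ?expr0n.
have x1 : sqn x = 1 by rewrite sqn_isometry.
pose lam := cos theta ^+ 2.
pose m : R := \sum_(V <- X | V != W) 1.
have sumE j : \sum_(V <- X) sqn ((Q V)^T *m x) ^+ j = 1 + m * lam ^+ j.
  rewrite (bigD1_seq W) //= /x mulmxA QQ mul1mx z1 expr1n; congr (_ + _).
  rewrite big_seq_cond mulr_suml [RHS]big_seq_cond.
  apply: eq_bigr => V /andP[VX VW].
  by rewrite (isoclinic_sqn z (bQ V) (bQ W) (iso V W VX WX VW)) z1 mulr1 mul1r.
have := sumE 0%N; have := sumE 1%N; have := sumE 2%N.
rewrite tight0 tight1 tight2 x1 !expr1n !mulr1 => e2 e1 e0.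
have dR : d%:R != 0 :> R by rewrite pnatr_eq0 -lt0n.
have d2R : (d%:R + 2 != 0 :> R) by rewrite -natrD pnatr_eq0 addn2.
have NR : N != 0.
  by rewrite cardX pnatr_eq0 cardfs_eq0; apply/fset0Pn; exists W.
have A1E : A1 = 2 * N / d%:R by rewrite /N addn0 muln0; field; rewrite dR.
have A2E : A2 = 8 * N / (d%:R * (d%:R + 2)).
  have -> : N = A2 * ((d%:R + 2) / 4) * (d%:R / 2).
    by rewrite /N /A1 muln0 muln1 !addn0 !natrD; field.
  by field; rewrite d2R dR.
(* Both sides are m ^+ 2 * lam ^+ 2, which eliminates lam. *)
have key : (A1 - 1) ^+ 2 = (N - 1) * (A2 - 1) by rewrite e2 e1 e0 expr1; ring.
have : N * (d%:R - 2) * (4 * N - d%:R ^+ 2) = 0.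
  have -> : N * (d%:R - 2) * (4 * N - d%:R ^+ 2)
    = d%:R ^+ 2 * (d%:R + 2) * ((N - 1) * (A2 - 1) - (A1 - 1) ^+ 2).
    by rewrite A1E A2E; field; rewrite d2R dR.
  by rewrite key subrr mulr0.
move/eqP; rewrite 2!mulf_eq0 (negPf NR) /= subr_eq0 eqr_nat (negPf d2) /=.
by rewrite subr_eq0 cardX -natrX -natrM eqr_nat => /eqP.
Qed.

Theorem corollary5p7 (R : realType) (d t : nat) (hd : odd d) (ht : (1 < t)%N) :
  ~ exists X : {fset grassmannian R 2 d}, EITFF t X.
Proof.
move=> [X EX].
have /(congr1 odd) : (4 * #|` X| = d ^ 2)%N.
  by apply: EITFF_card EX => //; [apply: odd_gt0 | apply: contraTneq hd => ->].
by rewrite oddM oddX hd.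
Qed.
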